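(* No algorithm can solve sorted-no-self-APSD enumeration on graphs with edge weights in $\{0,\dots,n^c\}$, for some constant $c$, with both delay and preprocessing in $o(m+n)$.
   Context: Input: a graph $G=(V,E)$ with $n$ vertices, $m$ edges and weights $w:E\to\{0,\dots,n^c\}$, given as read-only adjacency lists accessed via degree and next-neighbor (with weight) queries. $d(u,v)$ is the shortest weighted distance ($\infty$ if unreachable). Sorted-no-self-APSD enumeration: output each triple $(u,v,d(u,v))$ with $u\neq v$ exactly once, in nondecreasing order of $d(u,v)$. Preprocessing: time before enumeration starts; delay: maximum time to first output after preprocessing, between consecutive outputs, and until termination is signalled. *)

(* Defs.v *)
From mathcomp Require Import all_boot all_order all_algebra.

Set Implicit Arguments.
Unset Strict Implicit.
Unset Printing Implicit Defensive.

(* A finite simple weighted graph on the vertices 0, ..., nv - 1, stored as one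
   adjacency list per vertex.  The neighbours of a vertex may be listed in any
   order.  The values of [wt] outside [edge] are irrelevant. *)
Record wgraph : Type := WGraph {
  nv : nat;
  edge : rel 'I_nv;
  wt : 'I_nv -> 'I_nv -> nat;
  adj : 'I_nv -> seq 'I_nv;
  edge_irrefl : irreflexive edge;
  adj_uniq : forall u, uniq (adj u);
  mem_adj : forall u v, (v \in adj u) = edge u v
}.

Definition undirected (G : wgraph) : Prop :=
  symmetric (@edge G) /\ forall u v : 'I_(nv G), edge u v -> wt u v = wt v u.

(* [directed = true]: all (di)graphs; [directed = false]: undirected ones. *)
Definition graph_class (directed : bool) (c : nat) (G : wgraph) : Prop :=
  (~~ directed -> undirected G) /\
  forall u v : 'I_(nv G), edge u v -> wt u v <= nv G ^ c.

(* An undirected edge, which occurs in two adjacency lists, counts once. *)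
Definition nedges (directed : bool) (G : wgraph) : nat :=
  #|[set e : 'I_(nv G) * 'I_(nv G) |
      edge e.1 e.2 && (directed || (e.1 < e.2))]|.

Fixpoint walk_weight (G : wgraph) (u : 'I_(nv G)) (p : seq 'I_(nv G)) : nat :=
  if p is v :: p' then wt u v + walk_weight v p' else 0.

(* Distances live in [option nat], where [None] is infinity. *)
Definition is_dist (G : wgraph) (u v : 'I_(nv G)) (d : option nat) : Prop :=
  let walk p := path (@edge G) u p /\ last u p = v in
  match d with
  | Some k => (exists2 p, walk p & walk_weight u p = k) /\
              (forall p, walk p -> k <= walk_weight u p)
  | None => forall p, ~ walk p
  end.

Definition dist_le (a b : option nat) : bool :=
  match a, b with
  | _, None => true
  | None, Some _ => false
  | Some k, Some l => k <= l
  end.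

Definition triple : Type := (nat * nat * option nat)%type.

Definition sorted_no_self_APSD (G : wgraph) (s : seq triple) : Prop :=
  [/\ uniq s,
      forall (u v : nat) (d : option nat), (u, v, d) \in s <->
        exists x y : 'I_(nv G),
          [/\ u = x, v = y, x != y & is_dist x y d]
    & sorted (fun t1 t2 : triple => dist_le t1.2 t2.2) s].

Definition degree_query (G : wgraph) (v : nat) : nat :=
  if insub v is Some x then size (@adj G x) else 0.

(* [next_query G v None] is the first entry of the list of v, and
   [next_query G v (Some u)] the entry after neighbour u; an entry comes with
   the weight of its edge.  The answer is [None] at the end of the list and for
   meaningless arguments. *)
Definition next_query (G : wgraph) (v : nat) (u : option nat) :
    option (nat * nat) :=
  if insub v is Some x then
    let s := @adj G x in
    let i := if u is Some k then (index k (map val s)).+1 else 0 in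
    omap (fun y : 'I_(nv G) => (val y, wt x y)) (onth s i)
  else None.

(* What a machine does in one unit of time; [Degree] and [NextNbr] pass the
   answer of the query to the continuation, [Start] ends the preprocessing, and
   [Halt] signals termination. *)
Inductive action (S : Type) : Type :=
| Compute of S
| Degree (v : nat) of (nat -> S)
| NextNbr (v : nat) (u : option nat) of (option (nat * nat) -> S)
| Start of S
| Emit of triple & S
| Halt.
Arguments Halt {S}.

(* A deterministic machine that knows n and m and reads the graph through
   queries only.  Neither the state space nor the transition function is
   restricted, so that RAMs with any instruction set and word size whose unit
   steps make at most one query or output are instances, and lower bounds for
   these machines do not depend on the choice of such a model. *)
Record algorithm : Type := Algorithm {
  state : Type;
  init : nat -> nat -> state;
  act : state -> action state
}.

Inductive event : Type := ETick | EStart | EEmit of triple | EHalt.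

(* [run G A s es]: started in s on G, A terminates and es lists the event of
   each of its steps. *)
Inductive run (G : wgraph) (A : algorithm) : state A -> seq event -> Prop :=
| RunCompute s s' es :
    act s = Compute s' -> run G s' es -> run G s (ETick :: es)
| RunDegree s v k es :
    act s = Degree v k -> run G (k (degree_query G v)) es ->
    run G s (ETick :: es)
| RunNextNbr s v u k es :
    act s = NextNbr v u k -> run G (k (next_query G v u)) es ->
    run G s (ETick :: es)
| RunStart s s' es :
    act s = Start s' -> run G s' es -> run G s (EStart :: es)
| RunEmit s t s' es :
    act s = Emit t s' -> run G s' es -> run G s (EEmit t :: es)
| RunHalt s :
    act s = Halt -> run G s [:: EHalt].

Definition is_tick (e : event) : bool := if e is ETick then true else false.
Definition is_start (e : event) : bool := if e is EStart then true else false.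

Definition outputs (es : seq event) : seq triple :=
  pmap (fun e => if e is EEmit t then Some t else None) es.

(* The numbers of steps from one output (initially: from the start of the
   enumeration, with k steps already elapsed) to the next output or to the
   termination signal, that step included. *)
Fixpoint gaps (k : nat) (es : seq event) : seq nat :=
  match es with
  | [::] => [::]
  | (EEmit _ | EHalt) :: es' => k.+1 :: gaps 0 es'
  | _ :: es' => gaps k.+1 es'
  end.

Definition delay (es : seq event) : nat := \max_(g <- gaps 0 es) g.

Definition solves_on (directed : bool) (A : algorithm) (G : wgraph)
    (pre_bound delay_bound : nat) : Prop :=
  exists pre enum : seq event,
    [/\ run G (init A (nv G) (nedges directed G)) (pre ++ EStart :: enum),
        all is_tick pre /\ ~~ has is_start enum,
        sorted_no_self_APSD G (outputs enum),
        size pre <= pre_bound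
      & delay enum <= delay_bound].

(* f(n, m) is o(n + m) as n + m tends to infinity. *)
Definition little_o_size (f : nat -> nat -> nat) : Prop :=
  forall eps : rat, (0 < eps)%R ->
    exists N : nat, forall n m : nat, N <= n + m ->
      ((f n m)%:R <= eps * (n + m)%:R)%R.

(* Main.v *)
Require Import Defs.
From mathcomp Require Import all_boot all_order all_algebra.
From mathcomp Require Import zify.

Set Implicit Arguments.
Unset Strict Implicit.
Unset Printing Implicit Defensive.

(** Adversary argument on a star whose spokes all have weight 1.  At most P + D
    steps precede the first output, and each of them reveals the weight of at
    most one spoke; as P + D is o(n), the weight of some spoke is never read.
    Lowering it to 0 does not change the run up to the first output, a triple
    whose distance is not 0, although a pair at distance 0 now has to come
    first. *)

(* Vertex 0 is the centre; [w i] is the weight of the spoke to leaf i, and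
   [maxn x y] is the leaf of the spoke between x and y. *)
Section Star.
Variables (n : nat) (w : nat -> nat).

Definition star_edge : rel 'I_n := fun x y => (x == 0 :> nat) (+) (y == 0 :> nat).

Definition star_adj (x : 'I_n) : seq 'I_n := [seq y <- enum 'I_n | star_edge x y].

Lemma star_edge_irrefl : irreflexive star_edge.
Proof. by move=> x; rewrite /star_edge addbb. Qed.

Lemma star_adj_uniq x : uniq (star_adj x).
Proof. by rewrite filter_uniq ?enum_uniq. Qed.

Lemma mem_star_adj x y : (y \in star_adj x) = star_edge x y.
Proof. by rewrite mem_filter mem_enum andbT. Qed.

Definition star : wgraph :=
  @WGraph n star_edge (fun x y => w (maxn x y)) star_adj
    star_edge_irrefl star_adj_uniq mem_star_adj.

Lemma star_undirected : undirected star.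
Proof.
by split=> x y; [rewrite /= /star_edge addbC | move=> _ /=; rewrite maxnC].
Qed.

Lemma star_graph_class directed c :
  (forall i, w i <= 1) -> graph_class directed c star.
Proof.
move=> w1; split=> [_|x y _]; first exact: star_undirected.
(* The vertex [x] forces [n] to be positive, so [1 <= n ^ c] even for [c = 0]. *)
by rewrite (leq_trans (w1 _)) //= expn_gt0 (leq_ltn_trans _ (ltn_ord x)).
Qed.

Lemma nedges_star directed : nedges directed star <= n.*2.
Proof.
rewrite -mul2n -card_bool -[X in _ * X]card_ord -card_prod.
(* An ordered edge is determined by its orientation and its leaf, the other end being the centre. *)
pose f (e : 'I_n * 'I_n) := (e.1 == 0 :> nat, if e.1 == 0 :> nat then e.2 else e.1).
rewrite /nedges -(card_in_imset (f := f)); first exact: max_card.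
move=> [x y] [x' y']; rewrite !inE /= => /andP[xy _] /andP[xy' _] [] E.
move: xy xy'; rewrite /star_edge -E.
case: eqP E => /= [x0 /esym/eqP x'0 _ _ ->|_ _ /eqP y0 /eqP y'0 ->].
  by congr pair; apply: val_inj; rewrite /= x0 x'0.
by congr pair; apply: val_inj; rewrite /= y0 y'0.
Qed.

End Star.

(** Which neighbour comes next is independent of the weights; only the weight reported with it can
    differ. *)
Lemma next_query_star n w w' v u :
  (if next_query (star n w) v u is Some (y, _)
   then w' (maxn v y) = w (maxn v y) else True) ->
  next_query (star n w') v u = next_query (star n w) v u.
Proof.
rewrite /next_query; case: insubP => //= x _ <-.
by case: onth => //= y ->.
Qed.

(** [T] collects the leaves of the spokes whose weights are read during [p]. While these weights
    agree, all answers agree, and a deterministic machine repeats [p]. *)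
Lemma run_star_agree n w (A : algorithm) (s : state A) p r :
  run (star n w) s (p ++ r) ->
  exists T : seq nat, size T <= size p /\
    forall w', {in T, w' =1 w} ->
    forall es, run (star n w') s es -> exists r', es = p ++ r'.
Proof.
elim: p s => [|e p IH] s; first by exists [::]; split=> // w' _ es _; exists es.
move=> R; inversion R as [? s' ? a R'|? v k ? a R'|? v u k ? a R'|? s' ? a R'
                         |? t s' ? a R'|? a]; subst.
6: exists [::]; split=> // w' _ es R2; inversion R2; subst; try congruence.
6: by exists [::]; case: (p) H1.
(* None of these actions, [Degree] included, reveals a weight, so [T] comes from the rest of the
   run. *)
1,2,4,5: have [T [sT HT]] := IH _ R'; exists T; split; first exact: leqW.
1,2,3,4: move=> w' ww' es R2; inversion R2 as [? ? es2 b R2'|? ? ? es2 b R2'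
           |? ? ? ? es2 b R2'|? ? es2 b R2'|? ? ? es2 b R2'|]; subst; try congruence;
         move: b R2'; rewrite a => -[] *; subst.
1,2,3,4: by have [|r' ->] := HT w' ww' es2; last by exists r'.
have [T [sT HT]] := IH _ R'.
exists ((if next_query (star n w) v u is Some (y, _) then [:: maxn v y] else [::])
        ++ T); split.
  by rewrite size_cat /= -add1n leq_add //; case: next_query => [[]|].
move=> w' ww' es R2; inversion R2 as [|? ? ? ? b|? ? ? ? es2 b R2'|? ? ? b|? ? ? ? b|];
  subst; try congruence.
move: b R2'; rewrite a => -[<- <- <-].
rewrite (@next_query_star n w w') => [R2'|].
  have [|r' ->] := HT w' _ es2 R2'; last by exists r'.
  by move=> i iT; apply: ww'; rewrite mem_cat iT orbT.
by case: next_query ww' => [[y ?]|] // -> //; rewrite mem_head.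
Qed.

Lemma run_halt G (A : algorithm) (s : state A) a b :
  run G s (a ++ EHalt :: b) -> b = [::].
Proof.
elim: a s => [|e a IH] s R; first by inversion R.
inversion R; subst; try by apply: IH; eassumption.
by case: (a) H2.
Qed.

Lemma outputs_cat es1 es2 : outputs (es1 ++ es2) = outputs es1 ++ outputs es2.
Proof. exact: pmap_cat. Qed.

Lemma outputs_ticks es : all is_tick es -> outputs es = [::].
Proof. by elim: es => [|[] es IH]. Qed.

(** Nothing follows a halt, so neither [EHalt] nor [EEmit] occurs in [a]: the counter of [gaps] is
    not reset there, and the first gap is [(size a + k).+1]. *)
Lemma first_output es t ts k :
  (forall a b, es = a ++ EHalt :: b -> b = [::]) ->
  outputs es = t :: ts ->
  exists a r, [/\ es = a ++ EEmit t :: r, outputs a = [::]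
    & size a + k < \max_(g <- gaps k es) g].
Proof.
elim: es k => // e es IH k halt.
have halt' a b : es = a ++ EHalt :: b -> b = [::].
  by move=> E; apply: (halt (e :: a) b); rewrite E.
case: e halt => [||t'|] halt /= E.
- have [a [r [-> oa lt_a]]] := IH k.+1 halt' E.
  by exists (ETick :: a), r; rewrite /= addSnnS.
- have [a [r [-> oa lt_a]]] := IH k.+1 halt' E.
  by exists (EStart :: a), r; rewrite /= addSnnS.
- case: E => -> _; exists [::], es; split=> //.
  by rewrite big_cons leq_maxl.
- by move: E; rewrite /outputs /= (halt [::] es).
Qed.

Lemma walk_weight_gt0 (G : wgraph) (x y : 'I_(nv G)) p :
  (forall u v : 'I_(nv G), 0 < wt u v) -> x != y -> last x p = y ->
  0 < walk_weight x p.
Proof.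
by move=> wt0; case: p => /= [xy E|v p _ _]; [rewrite E eqxx in xy | rewrite ltn_addr].
Qed.

Lemma sorted_head_dist0 (t : triple) ts u v :
  sorted (fun t1 t2 : triple => dist_le t1.2 t2.2) (t :: ts) ->
  (u, v, Some 0) \in t :: ts -> t.2 = Some 0.
Proof.
move=> /= /order_path_min => H.
have {H} : all (fun t2 : triple => dist_le t.2 t2.2) ts.
  by apply: H => -[[? ?] [y|]] [[? ?] [x|]] [[? ?] [z|]] //=; apply: leq_trans.
rewrite inE => /allP le_t /predU1P [<- //|/le_t].
by case: t {le_t} => [[? ?] [[|k]|]].
Qed.

Lemma little_o_size_dominated (f : nat -> nat -> nat) k :
  little_o_size f -> exists N, forall n m, N <= n + m -> k * f n m <= n + m.
Proof.
case: k => [|k]; first by exists 0.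
move=> /(_ (k.+1%:R^-1)%R) [|N HN]; first by rewrite Num.Theory.invr_gt0 Num.Theory.ltr0n.
exists N => n m /HN.
rewrite GRing.mulrC Num.Theory.ler_pdivlMr ?Num.Theory.ltr0n //.
by rewrite -GRing.natrM Num.Theory.ler_nat mulnC.
Qed.

(** The events up to and including the first output number at most [p + d + 1], and all [n.-1]
    spokes have to be read among them. *)
Lemma star_first_output_slow directed (A : algorithm) n p d :
  (forall w, (forall i, w i <= 1) -> solves_on directed A (star n w) p d) ->
  n <= p + d + 2.
Proof.
move=> sol; rewrite leqNgt; apply/negP=> lt_n.
have n0 : 0 < n by lia.
have n1 : 1 < n by lia.
pose zero := Ordinal n0.
have [//|pre [enum [R [tick_pre _] [uniq_o mem_o sorted_o] size_pre del]]] :=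
  sol (fun=> 1).
(* This triple only serves to show that there is a first output. *)
have : (0, 1, Some 1) \in outputs enum.
  apply/mem_o; exists zero, (Ordinal n1); split=> //; split.
    by exists [:: Ordinal n1].
  by move=> q [_ lq]; apply: walk_weight_gt0 lq.
case E: (outputs enum) => [//|t ts] _.
have [a b E'|a [r [Eenum oa lt_a]]] := first_output 0 _ E.
  by move: R; rewrite E' -cat_cons catA; apply: run_halt.
have size_a : size a < d by rewrite addn0 in lt_a; apply: leq_trans del.
pose q := pre ++ EStart :: a ++ [:: EEmit t].
have out_q r' : outputs (q ++ r') = t :: outputs r'.
  by rewrite /q -catA !outputs_cat outputs_ticks //= outputs_cat oa.
have {}R : run (star n (fun=> 1)) (init A n (nedges directed (star n (fun=> 1)))) (q ++ r).
  by rewrite /q -catA /= -catA -Eenum.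
have [T [size_T HT]] := run_star_agree R.
(* If every leaf is in [T], then [n.-1 <= size q], which is too large; otherwise some leaf [i] is
   unread. *)
have [/allP sub|/allPn [i]] := boolP (all (mem T) (iota 1 n.-1)).
  have := uniq_leq_size (iota_uniq _ _) sub.
  move: size_T; rewrite /q size_iota size_cat /= size_cat /=; lia.
rewrite mem_iota => /andP [i_gt0 lt_in] /= iT.
have {}lt_in : i < n by lia.
(* Weight 0 on spoke [i], weight 1 on all others. *)
pose w' (j : nat) : nat := j != i.
have [|pre' [enum' [R' [tick_pre' _] [_ mem_o' sorted_o'] _ _]]] := sol w'.
  by move=> j; apply: leq_b1.
have [j jT|r' Er'] := HT w' _ _ R'.
  by rewrite /w'; case: eqP iT => // <-; rewrite jT.
have E' : outputs enum' = t :: outputs r'.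
  by rewrite -out_q -Er' outputs_cat (outputs_ticks tick_pre').
have : (0, i, Some 0) \in outputs enum'.
  apply/mem_o'; exists zero, (Ordinal lt_in); split=> //.
    by rewrite -val_eqE /= eq_sym -lt0n.
  split=> //; exists [:: Ordinal lt_in] => /=.
    by rewrite /star_edge /= eqn0Ngt i_gt0.
  by rewrite max0n /w' eqxx.
rewrite E' in sorted_o' * => /(sorted_head_dist0 sorted_o').
(* The same [t], now forced to have distance 0, was also output when all weights were 1, where
   distinct vertices have positive distance. *)
have : t \in outputs enum by rewrite E mem_head.
case: (t) => [[u v] d'] t_out /= d'0.
move: t_out; rewrite d'0 => /mem_o [x [y [_ _ xy [[s [_ ls] ws0] _]]]].
have := @walk_weight_gt0 (star n (fun=> 1)) x y s (fun _ _ => isT) xy ls.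
by rewrite ws0.
Qed.

Theorem theorem20 (directed : bool) (c : nat) :
  ~ exists (A : algorithm) (P D : nat -> nat -> nat),
      [/\ little_o_size P, little_o_size D
        & forall G : wgraph, graph_class directed c G ->
            solves_on directed A G
              (P (nv G) (nedges directed G)) (D (nv G) (nedges directed G))].
Proof.
move=> [A [P [D [/(little_o_size_dominated 8) [N leP]
  /(little_o_size_dominated 8) [M leD] sol]]]].
(* With [m <= 2n], both [8 * P n m] and [8 * D n m] are at most [3n]. Then [n <= P n m + D n m + 2]
   gives [8n <= 6n + 16], so [n <= 8], against [n >= 12]. *)
pose n := 12 + N + M; pose m := nedges directed (star n (fun=> 1)).
have sol_star w : (forall i, w i <= 1) ->
    solves_on directed A (star n w) (P n m) (D n m).
  by move=> w1; apply: sol (star_graph_class n directed c w1).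
have := star_first_output_slow sol_star.
have : m <= n.*2 := nedges_star n (fun=> 1) directed.
have := leP n m; have := leD n m.
lia.
Qed.
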